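(* If $d_*\ge0$ and $f_{j_*}=0$ for some integer $j_*\ge0$, then $$\mathbb P(\Theta=\emptyset)=\Phi_{j_*}(0)\cdot\prod_{j=j_*}^{\infty}\varphi_{0,j}(0)^{m_0\cdot\ldots\cdot m_{j-1}}.$$
   Context: Tree. $\mathbb N=\{1,2,\ldots\}$; $\mathcal U$ is the set of finite words over $\mathbb N$, including the empty word $\varnothing$; $\langle u\rangle$ is the length (generation) of $u$; for $u\ne\varnothing$, $\pi(u)$ is $u$ with its last letter removed. Fix integers $m_j\ge 2$ ($j\ge 0$). For $j\ge 0$, $\mathcal U_j=\{u\in\mathcal U:\ u_i\le m_{j+i-1}\text{ for }1\le i\le\langle u\rangle\}$ and $\mathcal U_j^*=\mathcal U_j\setminus\{\varnothing\}$. For $u\in\mathcal U_0$, $u\,\mathcal U_{\langle u\rangle}$ (resp. $u\,\mathcal U_{\langle u\rangle}^*$) is the set of concatenations of $u$ with words of $\mathcal U_{\langle u\rangle}$ (resp. $\mathcal U_{\langle u\rangle}^*$). Compacts. Fix $d\ge 1$, reals $0<\underline\beta\le\overline\beta<1$, and for each $j\ge0$ a probability measure $\mu_j$ on $[\underline\beta,\overline\beta]^{m_j}$. $(J_u)_{u\in\mathcal U_0}$ is a random family of compact subsets of $\mathbb R^d$ with positive diameters $|J_u|$, such that: (A) for each $u\in\mathcal U_0$, the sets $J_{uk}$, $1\le k\le m_{\langle u\rangle}$, are subsets of $J_u$ with disjoint interiors; (B) there is a real $\kappa>0$ such that for each $u\in\mathcal U_0$ the Lebesgue measure of the interior of $J_u$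 is at least $\kappa|J_u|^d$; (C) the ratios $L_u=|J_u|/|J_{\pi(u)}|$, $u\in\mathcal U_0^*$, are random variables and the vectors $(L_{uk})_{1\le k\le m_{\langle u\rangle}}$, $u\in\mathcal U_0$, are independent with respective distributions $\mu_{\langle u\rangle}$. Markov chain. For $j\ge0$ and $t\in\{0,1\}$ let $\nu_{t,j}$ be a probability measure on $\{0,1\}^{m_j}$. $(X_u)_{u\in\mathcal U_0}$ is a family of $\{0,1\}$-valued random variables, independent of $(L_u)_{u\in\mathcal U_0^*}$, such that for every $u\in\mathcal U_0$ and $A\subseteq\{0,1\}^{m_{\langle u\rangle}}$, $\mathbb P\big((X_{uk})_{1\le k\le m_{\langle u\rangle}}\in A\mid \mathcal G_u\big)=\nu_{X_u,\langle u\rangle}(A)$, where $\mathcal G_u=\sigma(X_v,\ v\in\mathcal U_0\setminus(u\,\mathcal U^*_{\langle u\rangle}))$. The set $\Theta$. Almost surely, for every sequence $\zeta=(\zeta_j)_{j\ge1}$ in $\mathbb N$ with $\zeta_1\ldots\zeta_j\in\mathcal U_0$ for all $j\ge 1$, the set $\bigcap_{j\ge1}J_{\zeta_1\ldots\zeta_j}$ is a single point, denoted $x_\zeta$. For $u\in\mathcal U_0$ let $\tau_u=\{v\in u\,\mathcal U_{\langle u\rangle}:\ X_{v_1\ldots v_j}=1\text{ for all }\langle u\rangle\le j\le\langle v\rangle\}$, $\partial\tau_u=\{\zeta\in\mathbb N^{\mathbb N}:\ \zeta_1\ldots\zeta_j\in\tau_u\text{ for all }j\ge\langle u\rangle\}$,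 $K_u=\{x_\zeta:\zeta\in\partial\tau_u\}$, and $\Theta=\bigcup_{u\in\mathcal U_0}K_u$. The number $d_*$. For $s\in\mathbb R$ and $j\ge0$, $\alpha_{s,j}=\int_{\{0,1\}^{m_j}}\int_{[\underline\beta,\overline\beta]^{m_j}}\sum_{k=1}^{m_j}\ell_k^s x_k\,\mu_j(d\ell)\,\nu_{1,j}(dx)$. Let $\underline j=\inf\{j_0\ge0:\ \alpha_{0,j}>0\ \text{for all } j\ge j_0\}$ (with $\inf\emptyset=\infty$). If $\underline j=\infty$, $d_*=-\infty$. Otherwise let $\rho(s)=\liminf_{j\to\infty}\frac1j\sum_{n=\underline j}^{j-1}\log\alpha_{s,n}$ for $s\in\mathbb R$ ($\rho$ is either identically $-\infty$ or a decreasing bijection of $\mathbb R$ onto $\mathbb R$) and $d_*=\sup\{s\in\mathbb R:\rho(s)>0\}=\inf\{s\in\mathbb R:\rho(s)<0\}\in[-\infty,\infty)$. Generating functions. For $j\ge0$, $S_j=\{u\in\mathcal U_0:\langle u\rangle=j,\ X_u=1\}$ and $\Phi_j(z)=\mathbb E[z^{\#S_j}]$ (with $0^0=1$). For $t\in\{0,1\}$, $\varphi_{t,j}(z)=\int_{\{0,1\}^{m_j}}z^{x_1+\cdots+x_{m_j}}\,\nu_{t,j}(dx)$. For $j\ge 0$, $f_j=\lim_{n\to\infty}\varphi_{1,j}\circ\cdots\circ\varphi_{1,j+n}(0)$ (a nondecreasing limit). The empty product $m_0\cdots m_{j-1}$ for $j=0$ equals $1$. *)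

(* Defs.v *)
From HB Require Import structures.
From mathcomp Require Import all_boot all_order all_algebra.
From mathcomp Require Import finmap.
From mathcomp Require Import all_classical all_reals all_analysis.
From mathcomp Require Import measurable_realfun.

Set Implicit Arguments.
Unset Strict Implicit.
Unset Printing Implicit Defensive.

Import Order.TTheory GRing.Theory Num.Theory.
Import numFieldNormedType.Exports.

Local Open Scope classical_set_scope.
Local Open Scope ring_scope.

(* Words over {1, 2, ...} are sequences of naturals.  The (i+1)-st letter of u
   is [nth 0 u i], so its bound m_{j+(i+1)-1} reads [m (j + i)]. *)
Definition words (m : nat -> nat) (j : nat) : set (seq nat) :=
  [set u | forall i, (i < size u)%N -> (1 <= nth 0 u i <= m (j + i))%N].

Definition words_star (m : nat -> nat) (j : nat) : set (seq nat) :=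
  words m j `\ [::].

Definition subtree (m : nat -> nat) (u : seq nat) : set (seq nat) :=
  cat u @` words m (size u).

Definition subtree_star (m : nat -> nat) (u : seq nat) : set (seq nat) :=
  cat u @` words_star m (size u).

Definition parent (u : seq nat) : seq nat := take (size u).-1 u.

Definition children_values (Omega E : Type) (m : nat -> nat)
    (Y : seq nat -> Omega -> E) (u : seq nat) (w : Omega) :
    (m (size u)).-tuple E :=
  [tuple Y (rcons u k.+1) w | k < m (size u)].

(* An infinite word zeta_1 zeta_2 ... is a function with zeta_{i+1} = zeta i;
   this is zeta_1 ... zeta_j. *)
Definition prefix_of (zeta : nat -> nat) (j : nat) : seq nat := mkseq zeta j.

(* The library norm on 'rV is the sup norm. *)
Definition eucl_norm (R : realType) (d : nat) (x : 'rV[R]_d) : R :=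
  Num.sqrt (\sum_i x ord0 i ^+ 2).

Definition diam (R : realType) (d : nat) (A : set 'rV[R]_d) : R :=
  sup [set eucl_norm (x - y) | x in A & y in A].

Definition Rd_box (R : realType) (d : nat) (a b : 'rV[R]_d) : set 'rV[R]_d :=
  [set x | forall i, a ord0 i <= x ord0 i <= b ord0 i].

(* d-dimensional Lebesgue outer measure; it coincides with Lebesgue measure on
   measurable sets, in particular on the open sets to which it is applied. *)
Definition lebesgue_Rd (R : realType) (d : nat) (A : set 'rV[R]_d) : \bar R :=
  ereal_inf [set s | exists a b : nat -> 'rV[R]_d,
    [/\ forall k i, a k ord0 i <= b k ord0 i,
        A `<=` \bigcup_k Rd_box (a k) (b k) &
        s = (\sum_(0 <= k <oo)
               (\prod_i (b k ord0 i - a k ord0 i))%:E)%E]].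

Definition mutually_independent (dO : measure_display)
    (Omega : measurableType dO) (R : realType) (P : probability Omega R)
    (I : eqType) (D : set I) (dE : I -> measure_display)
    (E : forall i, measurableType (dE i)) (Y : forall i, Omega -> E i) : Prop :=
  forall (s : seq I) (B : forall i, set (E i)),
    uniq s -> (forall i, i \in s -> D i) ->
    (forall i, i \in s -> measurable (B i)) ->
    P (\bigcap_(i in [set` s]) (Y i @^-1` B i)) =
    (\prod_(i <- s) P (Y i @^-1` B i))%E.

Definition sigma_gen (dO dE : measure_display) (Omega : measurableType dO)
    (E : measurableType dE) (I : Type) (D : set I) (Y : I -> Omega -> E) :
    set (set Omega) :=
  <<s \bigcup_(i in D) preimage_set_system setT (Y i) measurable >>.

Definition independent_sigma (dO : measure_display) (Omega : measurableType dO)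
    (R : realType) (P : probability Omega R) (F G : set (set Omega)) : Prop :=
  forall A B, F A -> G B -> P (A `&` B) = (P A * P B)%E.

(* f is a version of P(A | G). *)
Definition is_cond_prob (dO : measure_display) (Omega : measurableType dO)
    (R : realType) (P : probability Omega R) (G : set (set Omega))
    (A : set Omega) (f : Omega -> \bar R) : Prop :=
  (forall B : set (\bar R), measurable B -> G (f @^-1` B)) /\
  (forall C, G C -> P (A `&` C) = (\int[P]_(w in C) f w)%E).

Definition cube (R : realType) (beta0 beta1 : R) (n : nat) :
    set (n.-tuple R) :=
  [set l | forall k, beta0 <= tnth l k <= beta1].

Definition L_ratio (Omega : Type) (R : realType) (d : nat)
    (J : seq nat -> Omega -> set 'rV[R]_d) (u : seq nat) (w : Omega) : R :=
  diam (J u w) / diam (J (parent u) w).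

Definition random_compacts (dO : measure_display) (Omega : measurableType dO)
    (R : realType) (P : probability Omega R) (d : nat) (m : nat -> nat)
    (mu : forall j, probability ((m j).-tuple R) R)
    (J : seq nat -> Omega -> set 'rV[R]_d) : Prop :=
  (forall u w, words m 0 u -> compact (J u w) /\ 0 < diam (J u w)) /\
  (forall u w, words m 0 u ->
     (forall k, (1 <= k <= m (size u))%N -> J (rcons u k) w `<=` J u w) /\
     (forall k l, (1 <= k <= m (size u))%N -> (1 <= l <= m (size u))%N ->
        k <> l -> interior (J (rcons u k) w) `&` interior (J (rcons u l) w) = set0)) /\
  (exists kappa : R, 0 < kappa /\
     forall u w, words m 0 u ->
       ((kappa * diam (J u w) ^+ d)%:E <= lebesgue_Rd (interior (J u w)))%E) /\
  [/\ forall u, words_star m 0 u -> measurable_fun setT (L_ratio J u),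
      mutually_independent P (words m 0) (children_values m (L_ratio J)) &
      forall u, words m 0 u -> forall B, measurable B ->
        P (children_values m (L_ratio J) u @^-1` B) = mu (size u) B].

Definition markov_chain (dO : measure_display) (Omega : measurableType dO)
    (R : realType) (P : probability Omega R) (m : nat -> nat)
    (nu : bool -> forall j, probability ((m j).-tuple bool) R)
    (X : seq nat -> Omega -> bool) : Prop :=
  (forall u, words m 0 u -> measurable_fun setT (X u)) /\
  (forall u, words m 0 u -> forall A : set ((m (size u)).-tuple bool),
     is_cond_prob P (sigma_gen (words m 0 `\` subtree_star m u) X)
       (children_values m X u @^-1` A) (fun w => nu (X u w) (size u) A)).

(* The point x_zeta, i.e. the only element of the intersection of the
   J_{zeta_1 ... zeta_j}, j >= 1.  Almost surely, this intersection is a single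
   point for every zeta in the tree; off this event the value is conventional. *)
Definition branch_point (Omega : Type) (R : realType) (d : nat)
    (J : seq nat -> Omega -> set 'rV[R]_d) (zeta : nat -> nat) (w : Omega) :
    'rV[R]_d :=
  xget 0 [set x | \bigcap_(j in [set j | (1 <= j)%N]) J (prefix_of zeta j) w
                  = [set x]].

Definition tau (Omega : Type) (m : nat -> nat) (X : seq nat -> Omega -> bool)
    (u : seq nat) (w : Omega) : set (seq nat) :=
  [set v | subtree m u v /\
     forall j, (size u <= j <= size v)%N -> X (take j v) w].

Definition boundary (Omega : Type) (m : nat -> nat)
    (X : seq nat -> Omega -> bool) (u : seq nat) (w : Omega) :
    set (nat -> nat) :=
  [set zeta | forall j, (size u <= j)%N -> tau m X u w (prefix_of zeta j)].

Definition K_set (Omega : Type) (R : realType) (d : nat) (m : nat -> nat)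
    (J : seq nat -> Omega -> set 'rV[R]_d) (X : seq nat -> Omega -> bool)
    (u : seq nat) (w : Omega) : set 'rV[R]_d :=
  [set branch_point J zeta w | zeta in boundary m X u w].

Definition Theta_set (Omega : Type) (R : realType) (d : nat) (m : nat -> nat)
    (J : seq nat -> Omega -> set 'rV[R]_d) (X : seq nat -> Omega -> bool)
    (w : Omega) : set 'rV[R]_d :=
  \bigcup_(u in words m 0) K_set m J X u w.

Definition alpha (R : realType) (m : nat -> nat) (beta0 beta1 : R)
    (mu : forall j, probability ((m j).-tuple R) R)
    (nu : bool -> forall j, probability ((m j).-tuple bool) R)
    (s : R) (j : nat) : R :=
  \int[nu true j]_x \int[mu j]_(l in cube beta0 beta1 (n := m j))
    \sum_(k < m j) (tnth l k `^ s) * (tnth x k)%:R.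

Definition eventually_pos (R : realType) (a : nat -> R) (j0 : nat) : Prop :=
  forall j, (j0 <= j)%N -> 0 < a j.

Definition rho (R : realType) (a : R -> nat -> R) (j0 : nat) (s : R) : \bar R :=
  limn_einf (fun j => (j%:R^-1 * \sum_(j0 <= n < j) ln (a s n))%:E).

(* a s j stands for alpha_{s,j}; the [ex_minn] is the least index from which on
   all alpha_{0,j} are positive. *)
Definition d_star (R : realType) (a : R -> nat -> R) : \bar R :=
  if pselect (exists j0, `[< eventually_pos (a 0) j0 >]) is left h
  then ereal_sup [set s%:E | s in [set s | (0 < rho a (ex_minn h) s)%E]]
  else -oo%E.

Definition ones_at (Omega : Type) (m : nat -> nat) (X : seq nat -> Omega -> bool)
    (j : nat) (w : Omega) : set (seq nat) :=
  [set u | [/\ words m 0 u, size u = j & X u w]].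

Definition gen_Phi (dO : measure_display) (Omega : measurableType dO)
    (R : realType) (P : probability Omega R) (m : nat -> nat)
    (X : seq nat -> Omega -> bool) (j : nat) (z : R) : \bar R :=
  'E_P[fun w => (z ^+ #|` fset_set (ones_at m X j w)|)%R]%E.

Definition gen_phi (R : realType) (m : nat -> nat)
    (nu : bool -> forall j, probability ((m j).-tuple bool) R)
    (t : bool) (j : nat) (z : R) : R :=
  \int[nu t j]_x z ^+ (\sum_(k < m j) tnth x k)%N.

(* phi_{1,j} o ... o phi_{1,j+n} *)
Definition gen_phi_iter (R : realType) (m : nat -> nat)
    (nu : bool -> forall j, probability ((m j).-tuple bool) R)
    (j n : nat) (z : R) : R :=
  foldr (gen_phi nu true) z (iota j n.+1).

Definition f_ext (R : realType) (m : nat -> nat)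
    (nu : bool -> forall j, probability ((m j).-tuple bool) R) (j : nat) : R :=
  lim (gen_phi_iter nu j n 0 @[n --> \oo]).

(* Main.v *)
Require Import Defs.
From HB Require Import structures.
From mathcomp Require Import all_boot all_order all_algebra.
From mathcomp Require Import all_classical all_reals all_analysis.
From mathcomp Require Import measurable_realfun.
From mathcomp Require Import zify.
Import Order.TTheory GRing.Theory Num.Theory.
Import numFieldNormedType.Exports.
Local Open Scope classical_set_scope.
Local Open Scope ring_scope.

(** Emptiness of Theta is decided by the family X alone: K_u is an image of the
boundary of tau_u, so Theta is empty exactly when no vertex of the tree starts
an infinite line of ones.

The generating function of a vertex with value 1 in generation j is a power
series with nonnegative coefficients, so it vanishes at a point z >= 0 only if
z = 0 (gen_phi_eq0).  Since f_j is the limit of a nondecreasing sequence of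
compositions, f_{j*} = 0 makes all those compositions vanish at 0, and peeling
off the outer functions one by one gives phi_{1,j}(0) = 0 for all j >= j*
(f_ext_eq0).  By the Markov property, almost surely every vertex of generation
at least j* with value 1 then has a child with value 1
(negligible_dead_end), hence starts an infinite line of ones.  Conversely, an
infinite line of ones visits all late generations.  So, up to a null event,
Theta is empty if and only if X vanishes on all generations from j* on.

The probability of this last event comes from the Markov property, used for
one vertex after another (zeros_flatten): conditionally on X being zero on the
generations j*, ..., n, the next generation is zero with probability
phi_{0,n}(0) to the number m_0 ... m_{n-1} of vertices of generation n.  The
first factor, the probability that generation j* is zero, is Phi_{j*}(0), and
continuity of P along decreasing events gives the infinite product
(zeros_levels).

Since P need not be complete, a null difference with a measurable event does
not determine the probability of the event that Theta is empty: its own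
measurability is established too.  By compactness (boundary_alive), a vertex
starts an infinite line of ones if and only if it starts lines of ones of all
finite lengths, which is a countable combination of measurable conditions. *)

Set Implicit Arguments.
Unset Strict Implicit.
Unset Printing Implicit Defensive.

(** * Words, generations and descendants *)

Definition children (m : nat -> nat) (u : seq nat) : seq (seq nat) :=
  [seq rcons u k.+1 | k <- iota 0 (m (size u))].

Fixpoint level (m : nat -> nat) (n : nat) : seq (seq nat) :=
  if n is n'.+1 then flatten [seq children m u | u <- level m n']
  else [:: [::]].

(** The last generation comes first, so that a Markov step, which adds the
children of the previous generation, is a concatenation on the left. *)
Fixpoint levels (m : nat -> nat) (j n : nat) : seq (seq nat) :=
  if n is n'.+1 then level m (j + n) ++ levels m j n' else level m j.

Lemma childrenP {m : nat -> nat} {u v : seq nat} :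
  reflect (exists2 k, (1 <= k <= m (size u))%N & v = rcons u k)
          (v \in children m u).
Proof.
apply: (iffP mapP) => [[k]|[[|k] // km ->]].
  by rewrite mem_iota => km ->; exists k.+1.
by exists k => //; rewrite mem_iota.
Qed.

Lemma words_rcons (m : nat -> nat) (u : seq nat) (k : nat) :
  words m 0 (rcons u k) <-> words m 0 u /\ (1 <= k <= m (size u))%N.
Proof.
split=> [uk|[uw km] i].
  split=> [i iu|].
    by have := uk i; rewrite size_rcons nth_rcons iu; apply; rewrite ltnW.
  by have := uk (size u); rewrite size_rcons nth_rcons ltnn eqxx; apply.
rewrite size_rcons ltnS leq_eqVlt nth_rcons => /orP[/eqP->|iu].
  by rewrite ltnn eqxx.
by rewrite iu; exact: uw.
Qed.

Lemma mem_level (m : nat -> nat) (n : nat) (u : seq nat) :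
  u \in level m n <-> words m 0 u /\ size u = n.
Proof.
elim: n u => [|n IH] u /=.
  by rewrite inE; split=> [/eqP->|[_ /size0nil->]].
split=> [/flattenP[_ /mapP[v /IH[vw vn] ->]] /childrenP[k km ->]|[]].
  by split; [exact/words_rcons|rewrite size_rcons vn].
case/lastP: u => // v k /words_rcons[vw km]; rewrite size_rcons => -[vn].
apply/flattenP; exists (children m v); first by apply: map_f; apply/IH.
by apply/childrenP; exists k.
Qed.

Lemma mem_levels (m : nat -> nat) (j n : nat) (u : seq nat) :
  u \in levels m j n <-> words m 0 u /\ (j <= size u <= j + n)%N.
Proof.
elim: n => [|n IH] /=.
  rewrite mem_level addn0; split=> -[uw]; first by move=> ->; rewrite leqnn.
  by move=> h; split=> //; apply/eqP; rewrite eqn_leq andbC.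
rewrite mem_cat; split.
  move=> /orP[/mem_level[uw ->]|/IH[uw /andP[ju un]]].
    by rewrite leq_addr leqnn.
  by rewrite ju addnS (leq_trans un).
move=> [uw /andP[ju]]; rewrite leq_eqVlt => /orP[/eqP un|un].
  by apply/orP; left; apply/mem_level.
by apply/orP; right; apply/IH; rewrite ju -ltnS -addnS.
Qed.

Lemma level_uniq (m : nat -> nat) (n : nat) : uniq (level m n).
Proof.
elim: n => //= n IH.
apply: (@allpairs_uniq_dep _ _ _ (fun u k => rcons u k.+1) (level m n)
          (fun u => iota 0 (m (size u)))) => // [u _|]; first exact: iota_uniq.
by move=> [u k] [v l] _ _ /= /rcons_inj[-> ->].
Qed.

Lemma size_level (m : nat -> nat) (n : nat) :
  size (level m n) = (\prod_(i < n) m i)%N.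
Proof.
elim: n => [|n IH]; first by rewrite big_ord0.
rewrite big_ord_recr /= -IH size_flatten /shape -map_comp.
have : {in level m n, (size \o children m) =1 (fun=> m n)}.
  by move=> u /mem_level[_ un] /=; rewrite size_map size_iota un.
move/eq_in_map=> ->; elim: (level m n) => //= _ s ->.
by rewrite mulSn.
Qed.

Lemma subtreeP (m : nat -> nat) (u v : seq nat) : words m 0 u ->
  subtree m u v <-> words m 0 v /\ take (size u) v = u.
Proof.
move=> uw; split=> [[s sw <-]|[vw uv]].
  rewrite take_size_cat//; split=> // i; rewrite size_cat nth_cat => ius.
  case: (ltnP i (size u)) => iu; first exact: uw.
  by have := sw (i - size u)%N; rewrite subnKC// add0n; apply; lia.
exists (drop (size u) v); last by rewrite -{1}uv cat_take_drop.
move=> i; rewrite size_drop nth_drop => iv.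
by apply: (vw (size u + i)%N); lia.
Qed.

Lemma subtree_starP (m : nat -> nat) (u v : seq nat) :
  subtree_star m u v -> take (size u) v = u /\ (size u < size v)%N.
Proof.
move=> [s [_ /= s0] <-]; rewrite take_size_cat// size_cat.
by split=> //; case: s s0 => // ? ? _ /=; rewrite addnS ltnS leq_addr.
Qed.

Lemma subtree_star_child (m : nat -> nat) (u v w : seq nat) :
  size v = size u -> w \in children m v -> subtree_star m u w -> u = v.
Proof.
by move=> vu /childrenP[k _ ->] /subtree_starP[<- _]; rewrite -vu -cats1 take_size_cat.
Qed.

(** * Infinite lines of ones *)

(** A line of ones of n + 1 vertices starts at u.  The search is a Boolean
function of finitely many values of X, whence its measurability. *)
Fixpoint reach {Omega : Type} (m : nat -> nat) (X : seq nat -> Omega -> bool)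
    (n : nat) (u : seq nat) (w : Omega) : bool :=
  X u w && (if n is n'.+1 then
              has (fun v => reach m X n' v w) (children m u) else true).

Definition alive {Omega : Type} (m : nat -> nat) (X : seq nat -> Omega -> bool)
    (u : seq nat) (w : Omega) : Prop :=
  forall n, reach m X n u w.

Section Lines.
Variables (Omega : Type) (m : nat -> nat) (X : seq nat -> Omega -> bool).
Variable w : Omega.

Lemma reach_X n u : reach m X n u w -> X u w.
Proof. by case: n => [|n] /= /andP[]. Qed.

Lemma reachS n u : reach m X n.+1 u w -> reach m X n u w.
Proof.
elim: n u => [|n IH] u /= /andP[-> //] /hasP[v vu nv].
by apply/hasP; exists v => //; exact: IH.
Qed.

Lemma reach_le n n' u : (n <= n')%N -> reach m X n' u w -> reach m X n u w.
Proof.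
move=> /subnKC <-; elim: (n' - n)%N => [|k IH]; first by rewrite addn0.
by rewrite addnS => /reachS.
Qed.

(** If every child failed at some length, then u would fail past the largest of
these finitely many lengths. *)
Lemma alive_child u : alive m X u w -> exists2 v, v \in children m u & alive m X v w.
Proof.
move=> au; apply: contrapT => nv.
have /choice[N HN] : forall v, exists n, v \in children m u -> ~ reach m X n v w.
  move=> v; case: (pselect (v \in children m u)) => vu; last by exists 0%N.
  case: (pselect (exists n, ~ reach m X n v w)) => [[n]|nn]; first by exists n.
  exfalso; apply: nv; exists v => // n; apply: contrapT => nrn.
  by apply: nn; exists n.
have := au (\max_(v <- children m u) N v).+1 => /= /andP[_ /hasP[v vu]].
by move=> rv; apply: (HN v vu); apply: reach_le rv; exact: leq_bigmax_seq.
Qed.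

Lemma boundary_prefix u zeta j : words m 0 u -> boundary m X u w zeta ->
  (size u <= j)%N -> words m 0 (prefix_of zeta j) /\ X (prefix_of zeta j) w.
Proof.
move=> uw zu uj; have [/(subtreeP _ uw)[vw _] Xz] := zu _ uj; split=> //.
have := Xz j; rewrite size_mkseq uj leqnn take_oversize ?size_mkseq//.
exact.
Qed.

(** König's lemma, with a ray built by following surviving children. *)
Lemma boundary_alive u : words m 0 u ->
  boundary m X u w !=set0 <-> alive m X u w.
Proof.
move=> uw; split=> [[zeta zu] n|au].
  have pu : u = prefix_of zeta (size u).
    have [/(subtreeP _ uw)[_ +] _] := zu _ (leqnn (size u)).
    by rewrite /prefix_of take_oversize ?size_mkseq.
  rewrite pu; move: (leqnn (size u)); elim: n {2 3}(size u) => [|n IH] j uj /=.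
    by have [_ ->] := boundary_prefix uw zu uj.
  have [_ ->] := boundary_prefix uw zu uj.
  apply/hasP; exists (prefix_of zeta j.+1); last exact/IH/leqW.
  have [+ _] := boundary_prefix uw zu (leqW uj).
  rewrite /prefix_of mkseqS => /words_rcons[_ +].
  by rewrite size_mkseq => zj; apply/childrenP; exists (zeta j); rewrite ?size_mkseq.
have /choice[next Hn] : forall v, exists v',
    alive m X v w -> v' \in children m v /\ alive m X v' w.
  move=> v; case: (pselect (alive m X v w)) => [/alive_child[v' ? ?]|]; first by exists v'.
  by exists [::].
(* V n is the vertex of the ray n generations after u; the letters of zeta
   below index size u are then those of u. *)
pose V n := iter n next u.
have aV n : alive m X (V n) w by elim: n => //= n /Hn[].
have sV n : V n.+1 \in children m (V n) by have [] := Hn _ (aV n).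
have szV n : size (V n) = (size u + n)%N.
  elim: n => [|n IH]; first by rewrite addn0.
  by have /childrenP[k _ ->] := sV n; rewrite size_rcons IH addnS.
have wV n : words m 0 (V n).
  by elim: n => //= n IH; have /childrenP[k km] := sV n; rewrite /V /= => ->; apply/words_rcons.
have tV n k : take (size u + n) (V (n + k)%N) = V n.
  elim: k => [|k IH]; first by rewrite addn0 take_oversize ?szV.
  rewrite addnS; have /childrenP[l _ ->] := sV (n + k)%N.
  by rewrite -cats1 takel_cat ?IH// szV addnA leq_addr.
have tuV n : take (size u) (V n) = u by have := tV 0%N n; rewrite addn0.
pose zeta i := nth 0%N (V i.+1) i.
have pV n : prefix_of zeta (size u + n) = V n.
  apply: (@eq_from_nth _ 0%N) => [|i]; rewrite size_mkseq ?szV// => iun.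
  rewrite nth_mkseq// /zeta.
  case: (leqP n i.+1) => ni.
    by rewrite -(tV n (i.+1 - n)%N) subnKC// nth_take.
  rewrite -(tV i.+1 (n - i.+1)%N) subnKC; last exact: ltnW.
  by rewrite nth_take// addnS ltnS leq_addl.
exists zeta => j uj; rewrite -(subnKC uj) pV; split.
  by apply/(subtreeP _ uw).
move=> i; rewrite szV => /andP[ui ij].
have -> : (j - size u = (i - size u) + (j - i))%N by lia.
by rewrite -{1}(subnKC ui) tV; exact: (reach_X (aV _ 0%N)).
Qed.

Lemma Theta_set0P (R : realType) (d : nat) (J : seq nat -> Omega -> set 'rV[R]_d) :
  Theta_set m J X w = set0 <-> forall u, words m 0 u -> ~ alive m X u w.
Proof.
split=> [T0 u uw /(boundary_alive uw)[zeta uz]|na].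
  have : Theta_set m J X w (branch_point J zeta w) by exists u => //; exists zeta.
  by rewrite T0.
rewrite -subset0 => x [u uw [zeta uz _]].
by apply: (na u uw); apply/boundary_alive => //; exists zeta.
Qed.

Lemma Theta_set0_zero (R : realType) (d : nat) (J : seq nat -> Omega -> set 'rV[R]_d) j :
  (forall u, words m 0 u -> (j <= size u)%N -> ~~ X u w) ->
  Theta_set m J X w = set0.
Proof.
move=> X0; rewrite -subset0 => x [u uw [zeta uz _]].
have [vw] := boundary_prefix uw uz (leq_maxr j (size u)).
by apply/negP/X0 => //; rewrite size_mkseq leq_maxl.
Qed.

Lemma alive_no_dead_end j u :
  (forall v, words m 0 v -> (j <= size v)%N -> X v w ->
     has (X^~ w) (children m v)) ->
  words m 0 u -> (j <= size u)%N -> X u w -> alive m X u w.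
Proof.
move=> nd uw ju Xu n; elim: n u uw ju Xu => [|n IH] u uw ju Xu /=; rewrite Xu//=.
have /hasP[_ /childrenP[k km ->] Xv] := nd _ uw ju Xu.
apply/hasP; exists (rcons u k); first by apply/childrenP; exists k.
by apply: IH => //; [exact/words_rcons|rewrite size_rcons ltnW].
Qed.

End Lines.

(** * Generating functions *)

Lemma measurable_bool_tuple (n : nat) (A : set (n.-tuple bool)) : measurable A.
Proof.
apply: countable_measurable; last exact/finite_set_countable/finite_finset.
move=> t; have -> : [set t] =
    \bigcap_(i in [set: 'I_n]) ((fun x : n.-tuple bool => tnth x i) @^-1` [set tnth t i]).
  apply/seteqP; split=> [x -> i _ //|x xt].
  by apply/eq_from_tnth => i; have := xt i I.
apply: fin_bigcap_measurable => [|i _]; [exact: finite_finset|].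
rewrite -[X in measurable X]setTI.
exact: measurable_tnth.
Qed.

Section GeneratingFunctions.
Variables (R : realType) (m : nat -> nat).
Variable nu : bool -> forall j, probability ((m j).-tuple bool) R.

Lemma le_integral_nu (t : bool) (j : nat) (f g : (m j).-tuple bool -> R) :
  (forall x, 0 <= f x) -> (forall x, f x <= g x) -> (forall x, g x <= 1) ->
  \int[nu t j]_x f x <= \int[nu t j]_x g x.
Proof.
have bint (h : (m j).-tuple bool -> R) : (forall x, 0 <= h x <= 1) ->
    (nu t j).-integrable setT (EFin \o h).
  move=> h01; apply: measurable_bounded_integrable => //.
  - by rewrite ltey_eq fin_num_measure.
  - by move=> _ B _; exact: measurable_bool_tuple.
  - exists 1; split=> // M M1 x _ /=; have /andP[h0 h1] := h01 x.
    by rewrite ger0_norm// (le_trans h1)// ltW.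
move=> f0 fg g1; apply: le_Rintegral => //; apply: bint => x.
  by rewrite f0 (le_trans (fg x)).
by rewrite g1 (le_trans (f0 x)).
Qed.

Let total_prob (t : bool) (j : nat) (c : R) : \int[nu t j]_x c = c.
Proof.
by rewrite Rintegral_cst// [X in fine X](probability_setT (nu t j)) mulr1.
Qed.

Lemma gen_phi_ge0 t j z : 0 <= z -> 0 <= gen_phi nu t j z.
Proof. by move=> z0; apply: Rintegral_ge0 => x _; exact: exprn_ge0. Qed.

Lemma gen_phi_le1 t j z : 0 <= z <= 1 -> gen_phi nu t j z <= 1.
Proof.
move=> /andP[z0 z1]; rewrite -[leRHS](total_prob t j).
by apply: le_integral_nu => x //; [exact: exprn_ge0|exact: exprn_ile1].
Qed.

Lemma gen_phi_homo t j z z' : 0 <= z -> z <= z' -> z' <= 1 ->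
  gen_phi nu t j z <= gen_phi nu t j z'.
Proof.
move=> z0 zz' z'1; apply: le_integral_nu => x.
- exact: exprn_ge0.
- by rewrite lerXn2r// nnegrE// (le_trans z0).
- by rewrite exprn_ile1// (le_trans z0).
Qed.

(** At most m j children are ones, so the generating function is at least
z ^+ m j on [0, 1]. *)
Lemma gen_phi_eq0 t j z : 0 <= z <= 1 -> gen_phi nu t j z = 0 -> z = 0.
Proof.
move=> /andP[z0 z1] phi0; apply/eqP; rewrite -[_ == 0]andTb.
have : z ^+ m j <= 0.
  rewrite -phi0 -[leLHS](total_prob t j); apply: le_integral_nu => x.
  - exact: exprn_ge0.
  - apply: ler_wiXn2l => //; apply: (@leq_trans (\sum_(k < m j) 1)%N).
      by apply: leq_sum => k _; exact: leq_b1.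
    by rewrite sum_nat_const card_ord muln1.
  - exact: exprn_ile1.
by rewrite le_eqVlt ltNge exprn_ge0// orbF expf_eq0 => /andP[_ ->].
Qed.

(** Since 0 ^+ 0 = 1, only the absence of ones contributes at z = 0. *)
Lemma gen_phi0 t j :
  nu t j [set x : (m j).-tuple bool | (\sum_(k < m j) tnth x k)%N = 0%N] =
  (gen_phi nu t j 0)%:E.
Proof.
set A := [set x | _]; have mA : measurable A by exact: measurable_bool_tuple.
rewrite /gen_phi (_ : (fun x => _) = \1_A); last first.
  apply/funext => x; rewrite indicE /A expr0n; congr (_%:R : R); congr nat_of_bool.
  by apply/eqP/idP; rewrite inE.
by rewrite /Rintegral integral_indic// setIT fineK// fin_num_measure.
Qed.

Lemma iter_phi01 j n z : 0 <= z <= 1 ->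
  0 <= foldr (gen_phi nu true) z (iota j n) <= 1.
Proof.
move=> z01; elim: n j => //= n IH j.
by rewrite gen_phi_le1// gen_phi_ge0//; case/andP: (IH j.+1).
Qed.

Lemma iter_phi_homo j n z z' : 0 <= z -> z <= z' -> z' <= 1 ->
  foldr (gen_phi nu true) z (iota j n) <= foldr (gen_phi nu true) z' (iota j n).
Proof.
move=> z0 zz' z'1; elim: n j => //= n IH j.
have /andP[h0 _] : 0 <= foldr (gen_phi nu true) z (iota j.+1 n) <= 1.
  by rewrite iter_phi01// z0 (le_trans zz').
have /andP[_ h1] : 0 <= foldr (gen_phi nu true) z' (iota j.+1 n) <= 1.
  by rewrite iter_phi01// z'1 (le_trans z0).
exact: gen_phi_homo.
Qed.

Lemma iter_phi_eq0 j n :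
  foldr (gen_phi nu true) 0 (iota j n.+1) = 0 -> gen_phi nu true (j + n) 0 = 0.
Proof.
elim: n j => [|n IH] j; first by rewrite addn0.
rewrite [LHS]/= => /gen_phi_eq0 h; rewrite addnS -addSn; apply: IH; apply: h.
by apply: (@iter_phi01 j.+1 n.+1); rewrite lexx ler01.
Qed.

(** The compositions at 0 form a nondecreasing sequence of nonnegative numbers
with limit 0, so all of them are 0. *)
Lemma f_ext_eq0 j : f_ext nu j = 0 -> forall n, (j <= n)%N -> gen_phi nu true n 0 = 0.
Proof.
move=> f0 n jn.
have x01 : 0 <= (0 : R) <= 1 by rewrite lexx ler01.
have nd : nondecreasing_seq (fun n => gen_phi_iter nu j n 0).
  apply/nondecreasing_seqP => k; rewrite /gen_phi_iter -(addn1 k.+1) iotaD foldr_cat.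
  by apply: iter_phi_homo => //=; [exact: gen_phi_ge0|exact: gen_phi_le1].
have cv : cvgn (fun n => gen_phi_iter nu j n 0).
  apply: nondecreasing_is_cvgn => //; exists 1 => _ [k _ <-].
  by have /andP[] := iter_phi01 j k.+1 x01.
rewrite -(subnKC jn); apply: iter_phi_eq0; apply/eqP; rewrite eq_le.
have /andP[-> _] := iter_phi01 j (n - j).+1 x01; rewrite andbT -[leRHS]f0.
exact: (nondecreasing_cvgn_le nd cv (n - j)%N).
Qed.

End GeneratingFunctions.

(** * Events where prescribed vertices carry zeros *)

Definition zeros {Omega : Type} (X : seq nat -> Omega -> bool)
    (S : seq (seq nat)) : set Omega := [set w | all (fun v => ~~ X v w) S].

Lemma zeros_cat {Omega : Type} (X : seq nat -> Omega -> bool) S S' :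
  zeros X (S ++ S') = zeros X S `&` zeros X S'.
Proof. by apply/seteqP; split=> w; rewrite /zeros /= all_cat => /andP. Qed.

Section SigmaGen.
Variables (dO : measure_display) (Omega : measurableType dO).
Variables (X : seq nat -> Omega -> bool) (D : set (seq nat)).

Lemma sigma_genI A B :
  sigma_gen D X A -> sigma_gen D X B -> sigma_gen D X (A `&` B).
Proof.
pose G := \bigcup_(i in D) preimage_set_system setT (X i) measurable.
exact: (@measurableI _ (g_sigma_algebraType G)).
Qed.

Lemma sigma_gen_X v b : D v -> sigma_gen D X (X v @^-1` [set b]).
Proof.
move=> Dv; apply: sub_sigma_algebra; exists v => //.
by exists [set b] => //; rewrite setTI.
Qed.

Lemma sigma_gen_zeros S :
  (forall v, v \in S -> D v) -> sigma_gen D X (zeros X S).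
Proof.
elim: S => [|v S IH] SD.
  by rewrite (_ : zeros X [::] = setT);
    [exact: (@measurableT _ (g_sigma_algebraType _))|apply/seteqP; split].
rewrite -cat1s zeros_cat; apply: sigma_genI; last first.
  by apply: IH => u uS; apply: SD; rewrite inE uS orbT.
rewrite (_ : zeros X [:: v] = X v @^-1` [set false]).
  by apply: sigma_gen_X; apply: SD; rewrite inE eqxx.
by apply/seteqP; split=> w; rewrite /zeros /= andbT; [move/negbTE|move=> ->].
Qed.

Lemma sigma_gen_measurable A : (forall v, D v -> measurable_fun setT (X v)) ->
  sigma_gen D X A -> measurable A.
Proof.
move=> mX; apply: smallest_sub A; first exact: sigma_algebra_measurable.
by move=> _ [v Dv [B mB <-]]; exact: mX.
Qed.

End SigmaGen.

(** * Consequences of the Markov property *)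

Section Markov.
Variables (R : realType) (dO : measure_display) (Omega : measurableType dO).
Variables (P : probability Omega R) (m : nat -> nat).
Variable nu : bool -> forall j, probability ((m j).-tuple bool) R.
Variables (X : seq nat -> Omega -> bool) (hX : markov_chain P nu X).

Lemma zeros_children u : zeros X (children m u) =
  children_values m X u @^-1` [set x : (m (size u)).-tuple bool |
                           (\sum_(k < m (size u)) tnth x k)%N = 0%N].
Proof.
apply/seteqP; split=> w.
  move=> /allP /= zw; apply: big1 => k _; rewrite tnth_mktuple.
  apply/eqP; rewrite eqb0; apply: zw.
  by apply/childrenP; exists k.+1 => //=.
move=> /= /eqP; rewrite sum_nat_eq0 => /forallP zw.
apply/allP => _ /childrenP[[|k] // km ->].
by have := zw (Ordinal km); rewrite tnth_mktuple eqb0.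
Qed.

(** On C the value of X at u is t, so the conditional probability that all
children of u are zeros is the constant nu t {0} on C. *)
Lemma markov_zeros t u C : words m 0 u ->
  sigma_gen (words m 0 `\` subtree_star m u) X C -> C `<=` X u @^-1` [set t] ->
  P (zeros X (children m u) `&` C) =
  ((gen_phi nu t (size u) 0)%:E * P C)%E.
Proof.
move=> uw GC Ct; have [mX cX] := hX.
have mC : measurable C by apply: sigma_gen_measurable GC => v [vw _]; exact: mX.
rewrite zeros_children; set A := [set x | _].
have [_ ->//] := cX u uw A.
rewrite -gen_phi0 -[RHS]integral_cst//; apply: eq_integral => w /set_mem Cw.
by have /= -> := Ct w Cw.
Qed.

Lemma measurable_zeros S : (forall v, v \in S -> words m 0 v) ->
  measurable (zeros X S).
Proof. by move=> Sw; apply: sigma_gen_measurable (sigma_gen_zeros Sw); exact: hX.1. Qed.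

(** The families of siblings are added one at a time.  The children of the other
vertices of generation n are not descendants of u, so the event already built
belongs to the conditioning sigma-algebra at u. *)
Lemma zeros_flatten n (s S : seq (seq nat)) :
  uniq s -> (forall u, u \in s -> u \in level m n /\ u \in S) ->
  (forall v, v \in S -> words m 0 v /\ (size v <= n)%N) ->
  P (zeros X (flatten [seq children m u | u <- s] ++ S)) =
  ((gen_phi nu false n 0 ^+ size s)%:E * P (zeros X S))%E.
Proof.
move=> us sS Sn; elim: s us sS => [|u s IH] /=; first by rewrite expr0 mul1e.
move=> /andP[us ss] sS; have [/mem_level[uw un] uS] := sS u (mem_head _ _).
rewrite -catA zeros_cat (@markov_zeros false)//.
- rewrite IH//; last by move=> v vs; apply: sS; rewrite inE vs orbT.
  by rewrite un muleA -EFinM exprS.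
- apply: sigma_gen_zeros => v; rewrite mem_cat => /orP[/flatten_mapP[u' u's vu']|vS].
    have [/mem_level[u'w u'n] _] : u' \in level m n /\ u' \in S.
      by apply: sS; rewrite inE u's orbT.
    split; first by have /childrenP[k km ->] := vu'; exact/words_rcons.
    move=> /(subtree_star_child _ vu') uu'.
    by move/negP: us; apply; rewrite uu' // u'n un.
  have [vw vn] := Sn _ vS; split=> // /subtree_starP[_].
  by rewrite un ltnNge vn.
- move=> w; rewrite zeros_cat => -[_] /allP /(_ _ uS).
  by move=> /negbTE.
Qed.

Lemma zeros_levels j n : P (zeros X (levels m j n)) =
  (P (zeros X (level m j)) *
   (\prod_(j <= i < j + n) gen_phi nu false i 0 ^+ (\prod_(k < i) m k))%:E)%E.
Proof.
elim: n => [|n IH]; first by rewrite addn0 big_geq// mule1.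
rewrite addnS big_nat_recr ?leq_addr//= addnS.
rewrite (@zeros_flatten (j + n) (level m (j + n)) (levels m j n)).
- by rewrite size_level IH muleCA -EFinM mulrC.
- exact: level_uniq.
- move=> u un; split=> //; have [uw us] := (mem_level _ _ _).1 un.
  by apply/mem_levels; rewrite us leq_addr leqnn.
- by move=> v /mem_levels[vw /andP[]].
Qed.

Lemma gen_Phi0 j : gen_Phi P m X j 0 = P (zeros X (level m j)).
Proof.
rewrite -expectation_indic; last by apply: measurable_zeros => v /mem_level[].
congr expectation; apply/funext => w; rewrite indicE expr0n.
congr (_%:R : R); congr nat_of_bool.
have fO : finite_set (ones_at m X j w).
  apply: (@sub_finite_set _ _ [set` level m j]); last exact: finite_seq.
  by move=> u [uw us _]; exact/mem_level.
apply/idP/idP => [|/set_mem /allP zw].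
  rewrite finmap.cardfs_eq0 => /eqP /(fset_set_set0 fO) O0.
  apply/mem_set/allP => u /mem_level[uw us]; apply/negP => Xu.
  by have : ones_at m X j w u by []; rewrite O0.
rewrite (_ : ones_at m X j w = set0) ?fset_set0 ?finmap.cardfs0//.
rewrite -subset0 => u [uw us]; apply/negP/zw; exact/mem_level.
Qed.

Lemma measurable_reach n u : words m 0 u -> measurable_fun setT (reach m X n u).
Proof.
elim: n u => [|n IH] u uw /=; apply: measurable_and => //; try exact: hX.1.
have : forall v, v \in children m u -> words m 0 v.
  by move=> _ /childrenP[k km ->]; exact/words_rcons.
elim: (children m u) => //= v s IHs sw; apply: measurable_or.
  by apply: IH; apply: sw; exact: mem_head.
by apply: IHs => v' v's; apply: sw; rewrite inE v's orbT.
Qed.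

(** Boundaries are quantified over uncountably many rays, but survival to all
finite lengths at each word is a countable condition. *)
Lemma measurable_Theta_set0 (d : nat) (J : seq nat -> Omega -> set 'rV[R]_d) :
  measurable [set w | Theta_set m J X w = set0].
Proof.
rewrite (_ : [set w | _] = ~` \bigcup_u [set w | words m 0 u /\
    forall n, reach m X n u w]); last first.
  apply/seteqP; split=> w /=.
    by move=> /Theta_set0P T0 [u _ [uw au]]; exact: (T0 u uw au).
  by move=> na; apply/Theta_set0P => u uw au; apply: na; exists u.
apply: measurableC; apply: countable_bigcupT_measurable => [|u]; first exact: countableP.
case: (pselect (words m 0 u)) => uw; last first.
  by rewrite (_ : [set w | _] = set0)//; apply/seteqP; split=> w // -[].
rewrite (_ : [set w | _] = \bigcap_n (setT `&` reach m X n u @^-1` [set true])).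
  by apply: bigcapT_measurable => n; exact: measurable_reach.
apply/seteqP; split=> w /=; first by move=> [_ au] n _; split=> //; exact: au.
by move=> au; split=> // n; have [_] := au n I.
Qed.

(** For a fixed u the event has probability phi_{1,size u}(0) P(X_u = 1) = 0, and
there are countably many words. *)
Lemma negligible_dead_end j :
  (forall n, (j <= n)%N -> gen_phi nu true n 0 = 0) ->
  P.-negligible [set w | exists u, [/\ words m 0 u, (j <= size u)%N, X u w &
                                      ~~ has (X^~ w) (children m u)]].
Proof.
move=> phi0.
pose F k := if unpickle k is Some u then
  [set w | [/\ words m 0 u, (j <= size u)%N, X u w & ~~ has (X^~ w) (children m u)]]
  else set0.
suff nF k : P.-negligible (F k).
  apply: negligibleS (negligible_bigcup nF) => w [u hu].
  by exists (pickle u) => //; rewrite /F pickleK.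
rewrite /F; case: (unpickle k) => [u|]; last exact: negligible_set0.
case: (pselect (words m 0 u /\ (j <= size u)%N)) => [[uw ju]|nu']; last first.
  by apply: negligibleS (negligible_set0 P) => w [uw ju]; case: nu'.
have Gu : sigma_gen (words m 0 `\` subtree_star m u) X (X u @^-1` [set true]).
  by apply: sigma_gen_X; split=> // /subtree_starP[_]; rewrite ltnn.
exists (zeros X (children m u) `&` X u @^-1` [set true]); split.
- apply: measurableI.
    by apply: measurable_zeros => _ /childrenP[l lm ->]; exact/words_rcons.
  by rewrite -[X in measurable X]setTI; exact: hX.1.
- by rewrite (@markov_zeros true)// phi0// mul0e.
- by move=> w [_ _ Xu]; rewrite -all_predC.
Qed.

End Markov.

Unset Implicit Arguments.
Set Strict Implicit.
Set Printing Implicit Defensive.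

(** * The probability that Theta is empty *)

Theorem proposition1 (R : realType) (dO : measure_display)
    (Omega : measurableType dO) (P : probability Omega R)
    (m : nat -> nat) (hm : forall j, (2 <= m j)%N)
    (d : nat) (hd : (1 <= d)%N)
    (beta0 beta1 : R) (hbeta : [/\ 0 < beta0, beta0 <= beta1 & beta1 < 1])
    (mu : forall j, probability ((m j).-tuple R) R)
    (hmu : forall j, mu j (cube beta0 beta1 (n := m j)) = 1%E)
    (nu : bool -> forall j, probability ((m j).-tuple bool) R)
    (J : seq nat -> Omega -> set 'rV[R]_d)
    (hJ : random_compacts P mu J)
    (X : seq nat -> Omega -> bool)
    (hX : markov_chain P nu X)
    (hXL : independent_sigma P (sigma_gen (words m 0) X)
                               (sigma_gen (words_star m 0) (L_ratio J)))
    (hd_star : (0 <= d_star (alpha beta0 beta1 mu nu))%E)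
    (jstar : nat) (hf : f_ext nu jstar = 0) :
  P [set w | Theta_set m J X w = set0] =
  (gen_Phi P m X jstar 0 *
   (lim (\prod_(jstar <= j < n) gen_phi nu false j 0 ^+ (\prod_(i < j) m i)
           @[n --> \oo]))%:E)%E.
Proof.
set T := [set w | _].
pose F n := zeros X (levels m jstar n).
have mF n : measurable (F n).
  by apply: (measurable_zeros hX) => v /mem_levels[].
have mE : measurable (\bigcap_n F n) by exact: bigcapT_measurable.
have mT : measurable T by exact: (measurable_Theta_set0 hX).
have ET : \bigcap_n F n `<=` T.
  move=> w Ew; apply: (@Theta_set0_zero _ _ _ _ _ _ _ jstar) => u uw ju.
  have /allP := Ew (size u - jstar)%N I; apply.
  by apply/mem_levels; rewrite ju subnKC// leqnn.
have -> : P T = P (\bigcap_n F n).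
  rewrite (measureDI P mT mE) (setIidr ET) [X in (X + _)%E](_ : _ = 0%E) ?add0e//.
  apply/negligibleP; first exact: measurableD.
  apply: negligibleS (negligible_dead_end hX (f_ext_eq0 hf)) => w [Tw nE].
  apply: contrapT => nN; apply: nE => n _; apply/allP => u /mem_levels[uw /andP[ju _]].
  apply/negP => Xu; have := (Theta_set0P _ _ _ _).1 Tw u uw; apply.
  apply: (@alive_no_dead_end _ _ _ _ jstar) => // v vw jv Xv; apply: contrapT => nh.
  by apply: nN; exists v; split=> //; apply/negP.
pose a n := \prod_(jstar <= j < n) gen_phi nu false j 0 ^+ (\prod_(i < j) m i).
have x01 : 0 <= (0 : R) <= 1 by rewrite lexx ler01.
have a0 n : 0 <= a n by apply: prodr_ge0 => i _; rewrite exprn_ge0// gen_phi_ge0.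
have a_cvg : cvgn (fun n => a (n + jstar)%N).
  apply: nonincreasing_is_cvgn; last by exists 0 => _ [n _ <-]; exact: a0.
  apply/nonincreasing_seqP => n; rewrite addSn /a big_nat_recr ?leq_addl//=.
  by rewrite ler_piMr ?a0// exprn_ile1 ?gen_phi_ge0 ?gen_phi_le1.
have al : (fun n => a (n + jstar)%N) @ \oo --> limn a.
  by have /cvg_ex[l al] := a_cvg; have := al; rewrite cvg_shiftn => /cvg_lim ->.
rewrite (gen_Phi0 hX); set p := P (zeros X _).
have pf : p \is a fin_num.
  by apply: fin_num_measure; apply: (measurable_zeros hX) => v /mem_level[].
have PF : P \o F = fun n => (fine p * a (n + jstar)%N)%:E.
  by apply/funext => n /=; rewrite (zeros_levels hX) EFinM fineK// addnC.
have FE : P \o F @ \oo --> P (\bigcap_n F n).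
  apply: nonincreasing_cvg_mu => //; first by rewrite ltey_eq fin_num_measure.
  apply/nonincreasing_seqP => n; apply/subsetPset; rewrite /F /= zeros_cat.
  exact: subIsetr.
rewrite PF in FE.
apply: (cvg_unique (@ereal_hausdorff R) FE); rewrite -[p]fineK// -EFinM.
by apply: cvg_EFin; [exact: nearW|exact: cvgMr].
Qed.
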